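(* With the notation below, $\hat I=(\hat I\cap\hat B)(\hat I\cap\hat B')$, and $(\hat I\cap\hat B)\cap(\hat I\cap\hat B')=\hat H$.
   Context: Let $F$ be a non-archimedean local field with ring of integers $\mathfrak{o}$, uniformizer $\varpi$, and finite residue field of cardinality $q$. $X=X_{PGL_2(F)}$ is the Bruhat–Tits tree of $PGL_2(F)$: vertices are homothety classes of $\mathfrak{o}$-lattices in $F^2$, with $[L],[L']$ adjacent iff there are representatives with $\varpi L\subsetneq L'\subsetneq L$; it is $(q+1)$-regular. $d$ is the path-length distance; $\mathrm{Aut}(X)$ is the group of distance-preserving bijections of the vertex set with the topology of pointwise convergence, and $PGL_2(F)\hookrightarrow\mathrm{Aut}(X)$ via the linear action on lattices. For an edge $\eta=\{y_1,y_2\}$ and $e\ge1$, $B(\eta,e)=\{y:\min(d(y,y_1),d(y,y_2))\le e\}$, and $\hat G=\hat G^{(e)}=\{g\in\mathrm{Aut}(X):\forall\eta\ \exists g'\in PGL_2(F),\ g|_{B(\eta,e)}=g'|_{B(\eta,e)}\}$ for a fixed $e\ge1$. Ends are equivalence classes of infinite paths (agreeing after an index shift from some point on). Fix a doubly infinite path $(x_n)_{n\in\mathbb{Z}}$; let $\omega$ be the end of $(x_n)_{n\ge0}$ and $\omega'$ the end of $(x_{-n})_{n\ge0}$. Set $\hat B=\{g\in\hat G: g(\omega)=\omega\}$, $\hat B'=\{g\in\hat G: g(\omega')=\omega'\}$, $\hat N=\{b\in\hat B: b(x_i)=x_i\text{ for some }i\in\mathbb{Z}\}$, $\hat H=\{n\in\hat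 N: n(x_k)=x_k\ \forall k\in\mathbb{Z}\}$, and $\hat I=\{g\in\hat G: g(x_0)=x_0,\ g(x_1)=x_1\}$. *)

(* Defs.v *)
From HB Require Import structures.
From mathcomp Require Import all_boot all_order all_algebra.
Set Implicit Arguments. Unset Strict Implicit. Unset Printing Implicit Defensive.
Import Order.TTheory GRing.Theory Num.Theory.
Local Open Scope ring_scope.

Section BTTree.
Variable F : fieldType.

(** ** Non-archimedean local field: a field F with a normalized discrete
    valuation v (with uniformizer pi, v pi = 1), complete, with finite
    residue field.  [v 0] is irrelevant (junk value). *)

Definition is_dvaluation (v : F -> int) (pi : F) : Prop :=
  [/\ pi != 0, v pi = 1,
      (forall x y, x != 0 -> y != 0 -> v (x * y) = v x + v y) &
      (forall x y, x != 0 -> y != 0 -> x + y != 0 ->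
         (v x <= v (x + y)) || (v y <= v (x + y)))].

Definition in_o (v : F -> int) (x : F) : bool := (x == 0) || (0 <= v x).
Definition in_p (v : F -> int) (x : F) : bool := (x == 0) || (1 <= v x).

Definition residue_finite (v : F -> int) : Prop :=
  exists s : seq F, all (in_o v) s /\
    forall x, in_o v x -> has (fun a => in_p v (x - a)) s.

Definition vclose (v : F -> int) (M : int) (a b : F) : bool :=
  (a - b == 0) || (M <= v (a - b)).

Definition v_complete (v : F -> int) : Prop :=
  forall u : nat -> F,
    (forall M : int, exists N : nat, forall m n : nat,
        (N <= m)%N -> (N <= n)%N -> vclose v M (u m) (u n)) ->
    exists l : F, forall M : int, exists N : nat, forall n : nat,
        (N <= n)%N -> vclose v M (u n) l.

Definition is_local_field (v : F -> int) (pi : F) : Prop :=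
  [/\ is_dvaluation v pi, residue_finite v & v_complete v].

Definition is_lattice (v : F -> int) (L : 'rV[F]_2 -> Prop) : Prop :=
  [/\ L 0,
      (forall a b, L a -> L b -> L (a + b)),
      (forall c a, in_o v c -> L a -> L (c *: a)),
      (exists s : seq 'rV[F]_2, (forall a, a \in s -> L a) /\
         forall w, L w -> exists c : 'I_(size s) -> F,
            (forall i, in_o v (c i)) /\ w = \sum_(i < size s) c i *: s`_i) &
      (exists a b, [/\ L a, L b & \det (col_mx a b) != 0])].

Definition homothetic (L L' : 'rV[F]_2 -> Prop) : Prop :=
  exists c : F, c != 0 /\ forall w, L' w <-> exists u, L u /\ w = c *: u.

Definition is_vertex_class (v : F -> int) (C : ('rV[F]_2 -> Prop) -> Prop) : Prop :=
  exists L, is_lattice v L /\ forall L', C L' <-> (is_lattice v L' /\ homothetic L L').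

Definition Vertex (v : F -> int) := { C : ('rV[F]_2 -> Prop) -> Prop | is_vertex_class v C }.

Definition strict_sub (A B : 'rV[F]_2 -> Prop) : Prop :=
  (forall w, A w -> B w) /\ exists w, B w /\ ~ A w.

Variable v : F -> int.
Variable pi : F.

Definition adj (x y : Vertex v) : Prop :=
  exists L L', proj1_sig x L /\ proj1_sig y L' /\
    strict_sub (fun w => exists u, L u /\ w = pi *: u) L' /\ strict_sub L' L.

Definition walk (x y : Vertex v) (n : nat) : Prop :=
  exists p : nat -> Vertex v, [/\ p 0%N = x, p n = y &
    forall i, (i < n)%N -> adj (p i) (p i.+1)].

Definition dist (x y : Vertex v) (n : nat) : Prop :=
  walk x y n /\ forall m, walk x y m -> (n <= m)%N.

Definition is_aut (g : Vertex v -> Vertex v) : Prop :=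
  bijective g /\ forall x y n, dist x y n <-> dist (g x) (g y) n.

(** linear action of an invertible matrix A (element of PGL_2(F)) on vertices,
    as a (functional) relation: A maps x to y *)
Definition mat_act_rel (A : 'M[F]_2) (x y : Vertex v) : Prop :=
  exists L, proj1_sig x L /\ proj1_sig y (fun w => exists u, L u /\ w = u *m A).

Definition in_ball (y1 y2 : Vertex v) (e : nat) (y : Vertex v) : Prop :=
  exists n, (n <= e)%N /\ (dist y1 y n \/ dist y2 y n).

Definition in_Ghat (e : nat) (g : Vertex v -> Vertex v) : Prop :=
  is_aut g /\ forall y1 y2, adj y1 y2 ->
    exists A : 'M[F]_2, A \in unitmx /\
      forall y, in_ball y1 y2 e y -> mat_act_rel A y (g y).

Definition ray_equiv (r r' : nat -> Vertex v) : Prop :=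
  exists a b : nat, forall n, r (n + a)%N = r' (n + b)%N.

Definition fixes_end (g : Vertex v -> Vertex v) (r : nat -> Vertex v) : Prop :=
  ray_equiv (fun n => g (r n)) r.

Definition geodesic_line (x : int -> Vertex v) : Prop :=
  forall m n : int, dist (x m) (x n) (absz (m - n)).

Definition ray_plus (x : int -> Vertex v) : nat -> Vertex v := fun n => x (n%:Z).
Definition ray_minus (x : int -> Vertex v) : nat -> Vertex v := fun n => x (- (n%:Z)).

Definition Bhat (e : nat) (x : int -> Vertex v) (g : Vertex v -> Vertex v) : Prop :=
  in_Ghat e g /\ fixes_end g (ray_plus x).
Definition Bhat' (e : nat) (x : int -> Vertex v) (g : Vertex v -> Vertex v) : Prop :=
  in_Ghat e g /\ fixes_end g (ray_minus x).
Definition Nhat (e : nat) (x : int -> Vertex v) (g : Vertex v -> Vertex v) : Prop :=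
  Bhat e x g /\ exists i : int, g (x i) = x i.
Definition Hhat (e : nat) (x : int -> Vertex v) (g : Vertex v -> Vertex v) : Prop :=
  Nhat e x g /\ forall k : int, g (x k) = x k.
Definition Ihat (e : nat) (x : int -> Vertex v) (g : Vertex v -> Vertex v) : Prop :=
  [/\ in_Ghat e g, g (x 0) = x 0 & g (x 1) = x 1].

End BTTree.

(* Main.v *)
Require Import Defs.
From HB Require Import structures.
From mathcomp Require Import all_boot all_order all_algebra.
From mathcomp Require Import boolp zify ring.
Set Implicit Arguments.
Unset Strict Implicit.
Unset Printing Implicit Defensive.
Import Order.TTheory GRing.Theory Num.Theory.
Local Open Scope ring_scope.

(** Completeness of [F] makes every doubly infinite path without backtracking an
    apartment: in a suitable basis [a, b] of [F^2], [x_n] is the class of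
    [o a + pi^n o b] for all [n].  If [g] fixes [x_0] and [x_1], then [x_n] for
    [n >= 0] and [g x_n] for [n <= 0] again form such a path.  The matrix [u]
    sending a basis adapted to the first path to one adapted to the second fixes
    [x_n] for [n >= 0] and agrees with [g] on [x_n] for [n <= 0], so that
    [g = u (u^-1 g)] is the required factorization.  An element of [Ihat] that
    fixes an end of the line fixes far vertices of the corresponding half-line
    and its origin, hence everything in between. *)

Section Tree.
Variables (F : fieldType) (v : F -> int) (pi : F).
Hypothesis Hv : is_dvaluation v pi.
Local Notation O := (in_o v).
Implicit Types (s t c : F) (a b w u : 'rV[F]_2).

(** * The valuation and its ring [O] *)

Lemma pi_neq0 : pi != 0. Proof. by case: Hv. Qed.

Lemma valM s t : s != 0 -> t != 0 -> v (s * t) = v s + v t.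
Proof. by case: Hv => _ _ vM _; apply: vM. Qed.

Lemma val1 : v 1 = 0.
Proof.
by have := @valM 1 1 (oner_neq0 F) (oner_neq0 F); rewrite mulr1; lia.
Qed.

Lemma valN1 : v (-1) = 0.
Proof.
have n0 : (-1 : F) != 0 by rewrite oppr_eq0 oner_neq0.
by have := valM n0 n0; rewrite mulrNN mulr1 val1; lia.
Qed.

Lemma valV s : s != 0 -> v s^-1 = - v s.
Proof.
move=> s0; have sV0 : s^-1 != 0 by rewrite invr_eq0.
by have := valM s0 sV0; rewrite divff // val1; lia.
Qed.

Lemma valX n : v (pi ^+ n) = n%:Z.
Proof.
elim: n => [|n IHn]; first by rewrite expr0 val1.
have [_ vpi _ _] := Hv.
rewrite exprS valM ?pi_neq0 ?expf_neq0 ?pi_neq0 // IHn vpi; lia.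
Qed.

Lemma ino0 : O 0. Proof. by rewrite /in_o eqxx. Qed.

Lemma inoE s : s != 0 -> O s = (0 <= v s).
Proof. by rewrite /in_o => /negbTE ->. Qed.

Lemma ino1 : O 1.
Proof. by rewrite inoE ?oner_neq0 // val1. Qed.

Lemma inoM s t : O s -> O t -> O (s * t).
Proof.
have [->|s0] := eqVneq s 0; first by rewrite mul0r.
have [->|t0] := eqVneq t 0; first by rewrite mulr0.
by rewrite !inoE ?mulf_neq0 // valM //; lia.
Qed.

Lemma inoN s : O s -> O (- s).
Proof.
rewrite -mulN1r; apply: inoM.
by rewrite inoE ?oppr_eq0 ?oner_neq0 // valN1.
Qed.

Lemma inoD s t : O s -> O t -> O (s + t).
Proof.
have [->|s0] := eqVneq s 0; first by rewrite add0r.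
have [->|t0] := eqVneq t 0; first by rewrite addr0.
have [->|st0] := eqVneq (s + t) 0; first by rewrite ino0.
case: Hv => _ _ _ /(_ _ _ s0 t0 st0).
by rewrite !inoE // => /orP[] h hs ht; [apply: le_trans h|apply: le_trans h].
Qed.

Lemma inoB s t : O s -> O t -> O (s - t).
Proof. by move=> Os Ot; apply: inoD => //; apply: inoN. Qed.

Lemma inoX n : O (pi ^+ n).
Proof. by rewrite inoE ?expf_neq0 ?pi_neq0 // valX. Qed.

Lemma ino_pi : O pi.
Proof. exact: (inoX 1). Qed.

(** Valuation zero gives a unit and positive valuation a multiple of [pi]; this dichotomy stands in
    for computing in the residue field. *)
Lemma unit_or_pi s : O s ->
  s != 0 /\ O s^-1 \/ exists t, O t /\ s = pi * t.
Proof.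
have [p0 vpi _ _] := Hv.
have [->|s0 Os] := eqVneq s 0; first by right; exists 0; rewrite mulr0 ino0.
have [vs|vs] := boolP (v s == 0).
  by left; split=> //; rewrite inoE ?invr_eq0 // valV // (eqP vs).
right; exists (pi^-1 * s); split; last by rewrite mulVKf.
move: Os; rewrite !inoE ?mulf_neq0 ?invr_eq0 // valM ?invr_eq0 // valV // vpi.
by lia.
Qed.

(** * Lattices spanned by two vectors, and their determinants *)

Definition Lat a b : 'rV[F]_2 -> Prop :=
  fun w => exists s t, [/\ O s, O t & w = s *: a + t *: b].

(** The determinant of the matrix with rows [a] and [b], in coordinates so that [ring] proves its
    identities. *)
Definition det2 a b : F := a 0 0 * b 0 1 - a 0 1 * b 0 0.

Definition scale_set c (L : 'rV[F]_2 -> Prop) : 'rV[F]_2 -> Prop :=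
  fun w => exists u, L u /\ w = c *: u.

Definition mx_image (A : 'M[F]_2) (L : 'rV[F]_2 -> Prop) : 'rV[F]_2 -> Prop :=
  fun w => exists u, L u /\ w = u *m A.

Lemma row2P a b : a 0 0 = b 0 0 -> a 0 1 = b 0 1 -> a = b.
Proof.
move=> h0 h1; apply/rowP => i.
have [->//|->//] : i = 0 \/ i = 1.
by case: i => [[|[|//]]] Hi; [left|right]; apply/val_inj.
Qed.

Lemma det_mx2 (M : 'M[F]_2) : \det M = M 0 0 * M 1 1 - M 0 1 * M 1 0.
Proof.
have l00 : lift 0 0 = 1 :> 'I_2 by apply/val_inj.
have l10 : lift 1 0 = 0 :> 'I_2 by apply/val_inj.
rewrite (expand_det_row _ 0) big_ord_recl big_ord1 /cofactor !det_mx11.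
rewrite 4!mxE l00 l10 /= expr0 mul1r expr1 mulN1r mulrN.
by [].
Qed.

Lemma det_col2 a b : \det (col_mx a b) = det2 a b.
Proof.
have e0 i : col_mx a b 0 i = a 0 i.
  by rewrite -(col_mxEu a b); congr (col_mx a b _ _); apply/val_inj.
have e1 i : col_mx a b 1 i = b 0 i.
  by rewrite -(col_mxEd a b); congr (col_mx a b _ _); apply/val_inj.
rewrite det_mx2.
by rewrite !e0 !e1 /det2; ring.
Qed.

Lemma det2_swap a b : det2 b a = - det2 a b.
Proof. by rewrite /det2; ring. Qed.

Lemma det2_comb a b s t s' t' :
  det2 (s *: a + t *: b) (s' *: a + t' *: b) = (s * t' - t * s') * det2 a b.
Proof. by rewrite /det2 !mxE; ring. Qed.

Lemma det2Z a b s t : det2 (s *: a) (t *: b) = s * t * det2 a b.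
Proof. by rewrite /det2 !mxE; ring. Qed.

Lemma det2Zr a b t : det2 a (t *: b) = t * det2 a b.
Proof. by rewrite /det2 !mxE; ring. Qed.

Lemma det2_shear a b t : det2 (a + t *: b) b = det2 a b.
Proof. by rewrite /det2 !mxE; ring. Qed.

Lemma cramer a b w : det2 a b != 0 ->
  w = (det2 w b / det2 a b) *: a + (det2 a w / det2 a b) *: b.
Proof.
by move=> D0; apply: row2P; rewrite !mxE /det2; field; rewrite -/(det2 a b).
Qed.

Lemma Lat_mem a b s t : O s -> O t -> Lat a b (s *: a + t *: b).
Proof. by exists s, t. Qed.

Lemma Lat_l a b : Lat a b a.
Proof. by exists 1, 0; rewrite scale1r scale0r addr0 ino0 ino1. Qed.

Lemma Lat_r a b : Lat a b b.
Proof. by exists 0, 1; rewrite scale1r scale0r add0r ino0 ino1. Qed.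

Lemma LatD a b w u : Lat a b w -> Lat a b u -> Lat a b (w + u).
Proof.
move=> [s [t [Os Ot ->]]] [s' [t' [Os' Ot' ->]]].
exists (s + s'), (t + t'); split; rewrite ?inoD //.
by rewrite !scalerDl addrACA.
Qed.

Lemma LatZ a b c w : O c -> Lat a b w -> Lat a b (c *: w).
Proof.
move=> Oc [s [t [Os Ot ->]]]; exists (c * s), (c * t).
by rewrite !inoM // scalerDr !scalerA.
Qed.

Lemma Lat_sub a b a' b' w :
  Lat a' b' a -> Lat a' b' b -> Lat a b w -> Lat a' b' w.
Proof.
by move=> ha hb [s [t [Os Ot ->]]]; apply: LatD; apply: LatZ.
Qed.

Lemma Lat_eq a b a' b' :
  Lat a' b' a -> Lat a' b' b -> Lat a b a' -> Lat a b b' ->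
  Lat a b = Lat a' b'.
Proof.
by move=> *; apply/predeqP => w; split; apply: Lat_sub.
Qed.

Lemma Lat_swap a b : Lat a b = Lat b a.
Proof. by apply: Lat_eq; (exact: Lat_l || exact: Lat_r). Qed.

Lemma Lat_shear a b t : O t -> Lat (a + t *: b) b = Lat a b.
Proof.
move=> Ot; apply: Lat_eq; try exact: Lat_r.
- by apply: LatD; [apply: Lat_l | apply: LatZ => //; apply: Lat_r].
- rewrite -[X in Lat _ _ X](addrK (t *: b)) -scaleNr; apply: LatD.
    exact: Lat_l.
  by apply: LatZ; [apply: inoN | apply: Lat_r].
Qed.

Lemma Lat_scale a b c : scale_set c (Lat a b) = Lat (c *: a) (c *: b).
Proof.
apply/predeqP => w; split.
  move=> [u [[s [t [Os Ot ->]]] ->]]; exists s, t; split=> //.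
  by rewrite scalerDr !scalerA ![c * _]mulrC.
move=> [s [t [Os Ot ->]]]; exists (s *: a + t *: b).
split; first by exists s, t.
by rewrite scalerDr !scalerA ![c * _]mulrC.
Qed.

Lemma Lat_image A a b : mx_image A (Lat a b) = Lat (a *m A) (b *m A).
Proof.
apply/predeqP => w; split.
  move=> [u [[s [t [Os Ot ->]]] ->]]; exists s, t; split=> //.
  by rewrite mulmxDl -!scalemxAl.
move=> [s [t [Os Ot ->]]]; exists (s *: a + t *: b).
split; first by exists s, t.
by rewrite mulmxDl -!scalemxAl.
Qed.

Lemma det2_image A a b : det2 (a *m A) (b *m A) = det2 a b * \det A.
Proof. by rewrite -!det_col2 -mul_col_mx det_mulmx. Qed.

(** The quotient is the determinant of the matrix expressing [a], [b] in the basis [a'], [b'], and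
    its entries lie in [O]. *)
Lemma Lat_det_dvd a b a' b' : det2 a' b' != 0 -> Lat a' b' a -> Lat a' b' b ->
  O (det2 a b / det2 a' b').
Proof.
move=> D0 [s [t [Os Ot ->]]] [s' [t' [Os' Ot' ->]]].
by rewrite det2_comb mulfK // inoB // inoM.
Qed.

Lemma Lat_lattice a b : det2 a b != 0 -> is_lattice v (Lat a b).
Proof.
move=> D0; split.
- by exists 0, 0; rewrite ino0 !scale0r addr0.
- by move=> *; apply: LatD.
- by move=> *; apply: LatZ.
- exists [:: a; b]; split.
    by move=> u; rewrite !inE => /orP[]/eqP->; [apply: Lat_l|apply: Lat_r].
  move=> w [s [t [Os Ot ->]]].
  exists (fun i => if val i == 0%N then s else t).
  split; first by move=> i; case: ifP.
  by rewrite /= big_ord_recl big_ord1.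
- by exists a, b; rewrite det_col2; split=> //; [apply: Lat_l|apply: Lat_r].
Qed.

(** By bilinearity, the determinant of two combinations is an [O]-combination of determinants of
    pairs of generators. The abstract [Q] covers both uses in [lattice_basis]: vanishing, and
    divisibility by a fixed determinant. *)
Lemma span_det (Q : F -> Prop) (g : seq 'rV[F]_2) :
  Q 0 -> (forall s t, Q s -> Q t -> Q (s + t)) ->
  (forall c s, O c -> Q s -> Q (c * s)) ->
  (forall i j : 'I_(size g), Q (det2 g`_i g`_j)) ->
  forall c d : 'I_(size g) -> F, (forall i, O (c i)) -> (forall i, O (d i)) ->
  Q (det2 (\sum_(i < size g) c i *: g`_i) (\sum_(i < size g) d i *: g`_i)).
Proof.
move=> Q0 QD QM Qg c d Oc Od.
have Qr (j : 'I_(size g)) : Q (det2 (\sum_(i < size g) c i *: g`_i) g`_j).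
  elim/big_ind: _ => [|x y Qx Qy|i _].
  - by rewrite /det2 !mxE !mul0r subr0.
  - rewrite (_ : det2 _ _ = det2 x g`_j + det2 y g`_j); first exact: QD.
    by rewrite /det2 !mxE; ring.
  - rewrite (_ : det2 _ _ = c i * det2 g`_i g`_j).
    exact: QM (Oc i) (Qg i j).
    by rewrite /det2 !mxE; ring.
set z := (X in det2 X _) in Qr *.
elim/big_ind: _ => [|x y Qx Qy|i _].
- by rewrite /det2 !mxE !mulr0 subr0.
- rewrite (_ : det2 _ _ = det2 z x + det2 z y); first exact: QD.
  by rewrite /det2 !mxE; ring.
- rewrite (_ : det2 _ _ = d i * det2 z g`_i).
    exact: QM (Od i) (Qr i).
  by rewrite /det2 !mxE; ring.
Qed.

(* A pair of generators whose determinant has minimal valuation is a basis,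
   by Cramer's rule. *)
Lemma lattice_basis (L : 'rV[F]_2 -> Prop) : is_lattice v L ->
  exists a b, det2 a b != 0 /\ L = Lat a b.
Proof.
move=> [L0 LD LZ [g [gL gspan]] [a0 [b0 [La0 Lb0 Dab]]]].
rewrite det_col2 in Dab.
pose D (p : 'I_(size g) * 'I_(size g)) := det2 g`_p.1 g`_p.2.
have [p0 Dp0] : exists p, D p != 0.
  apply: contrapT => H; move/eqP: Dab; apply.
  have [c [Oc ->]] := gspan _ La0; have [d [Od ->]] := gspan _ Lb0.
  apply: (@span_det (fun s => s = 0)) => //.
  - by move=> s t -> ->; rewrite addr0.
  - by move=> t s _ ->; rewrite mulr0.
  - move=> i j; apply/eqP; apply: contrapT => /negP h.
    by apply: H; exists (i, j).
case: (@Order.TotalTheory.arg_minP _ _ _ p0 (fun p => D p != 0)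
         (fun p => v (D p)) Dp0) => -[i j] Dij Dmin.
exists g`_i, g`_j; split=> //.
have Lg (k : 'I_(size g)) : L g`_k by apply: gL; apply: mem_nth.
(* Divisibility by the minimal determinant puts both Cramer coefficients of a vector of [L] into
   [O]. *)
have min w u : L w -> L u -> O (det2 w u / D (i, j)).
  move=> Lw Lu.
  have [c [Oc ->]] := gspan _ Lw; have [d [Od ->]] := gspan _ Lu.
  apply: (@span_det (fun s => O (s / D (i, j)))) => //.
  - by rewrite mul0r ino0.
  - by move=> s t Os Ot; rewrite mulrDl inoD.
  - by move=> t s Ot Os; rewrite -mulrA inoM.
  - move=> k l; have [->|Dkl] := eqVneq (det2 g`_k g`_l) 0.
      by rewrite mul0r ino0.
    have := Dmin (k, l) Dkl.
    by rewrite inoE ?mulf_neq0 ?invr_eq0 // valM ?invr_eq0 // valV // subr_ge0.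
apply/predeqP => w; split.
  move=> Lw; rewrite (@cramer g`_i g`_j w) //.
  by apply: Lat_mem; apply: min.
by move=> [s [t [Os Ot ->]]]; apply: LD; apply: LZ.
Qed.

(** Each determinant divides the other in [O], so their quotient is a unit. *)
Lemma Lat_eq_val a b a' b' : det2 a b != 0 -> det2 a' b' != 0 ->
  Lat a b = Lat a' b' -> v (det2 a b) = v (det2 a' b').
Proof.
move=> D0 D0' E.
have h1 : O (det2 a b / det2 a' b').
  by apply: Lat_det_dvd => //; rewrite -E; [apply: Lat_l|apply: Lat_r].
have h2 : O (det2 a' b' / det2 a b).
  by apply: Lat_det_dvd => //; rewrite E; [apply: Lat_l|apply: Lat_r].
move: h1 h2; rewrite !inoE ?mulf_neq0 ?invr_eq0 //.
rewrite !valM ?invr_eq0 // !valV //; lia.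
Qed.

(** * Homothety of lattices *)

Lemma scale_setA c t (L : 'rV[F]_2 -> Prop) :
  scale_set c (scale_set t L) = scale_set (c * t) L.
Proof.
apply/predeqP => w; split=> [[_ [[u [Lu ->]] ->]]|[u [Lu ->]]].
  by exists u; rewrite scalerA.
by exists (t *: u); rewrite scalerA; split=> //; exists u.
Qed.

Lemma scale_set1 (L : 'rV[F]_2 -> Prop) : scale_set 1 L = L.
Proof.
apply/predeqP => w; split=> [[u [Lu ->]]|Lw]; first by rewrite scale1r.
by exists w; rewrite scale1r.
Qed.

Lemma homotheticP (L L' : 'rV[F]_2 -> Prop) :
  homothetic L L' <-> exists2 c, c != 0 & L' = scale_set c L.
Proof.
split=> [[c [c0 H]]|[c c0 ->]]; last by exists c.
by exists c => //; apply/predeqP.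
Qed.

Lemma homothetic_refl (L : 'rV[F]_2 -> Prop) : homothetic L L.
Proof. by apply/homotheticP; exists 1; rewrite ?oner_neq0 ?scale_set1. Qed.

Lemma homothetic_sym (L L' : 'rV[F]_2 -> Prop) :
  homothetic L L' -> homothetic L' L.
Proof.
move=> /homotheticP[c c0 ->]; apply/homotheticP; exists c^-1.
  by rewrite invr_eq0.
by rewrite scale_setA mulVf // scale_set1.
Qed.

Lemma homothetic_trans (L2 L1 L3 : 'rV[F]_2 -> Prop) :
  homothetic L1 L2 -> homothetic L2 L3 -> homothetic L1 L3.
Proof.
move=> /homotheticP[c c0 ->] /homotheticP[t t0 ->]; apply/homotheticP.
by exists (t * c); rewrite ?mulf_neq0 ?scale_setA.
Qed.

Lemma lattice_scale c (L : 'rV[F]_2 -> Prop) : c != 0 ->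
  is_lattice v L -> is_lattice v (scale_set c L).
Proof.
move=> c0 /lattice_basis[a [b [D0 ->]]]; rewrite Lat_scale.
by apply: Lat_lattice; rewrite det2Z !mulf_neq0.
Qed.

Lemma lattice_image A (L : 'rV[F]_2 -> Prop) : A \in unitmx ->
  is_lattice v L -> is_lattice v (mx_image A L).
Proof.
rewrite unitmxE unitfE => dA /lattice_basis[a [b [D0 ->]]]; rewrite Lat_image.
by apply: Lat_lattice; rewrite det2_image mulf_neq0.
Qed.

(** * Vertices and the bases that represent them *)

Implicit Types (x y z : Vertex v) (L : 'rV[F]_2 -> Prop).

Lemma vertex_ex x : exists L, sval x L.
Proof.
have [L [HL H]] := svalP x.
by exists L; apply/H; split=> //; apply: homothetic_refl.
Qed.

Lemma vertex_lattice x L : sval x L -> is_lattice v L.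
Proof. by have [L0 [_ H]] := svalP x; move=> /H[]. Qed.

Lemma vertex_homothetic x L L' : sval x L -> sval x L' -> homothetic L L'.
Proof.
have [L0 [_ H]] := svalP x; move=> /H[_ h] /H[_].
exact/homothetic_trans/homothetic_sym.
Qed.

Lemma vertex_closed x L L' :
  sval x L -> is_lattice v L' -> homothetic L L' -> sval x L'.
Proof.
have [L0 [_ H]] := svalP x; move=> /H[_ h] l' h'; apply/H; split=> //.
exact: homothetic_trans h'.
Qed.

(** Classes are closed under homothety, so one common lattice makes the two predicates equal; proof
    irrelevance settles the rest of the sigma type. *)
Lemma vertex_eq x y L : sval x L -> sval y L -> x = y.
Proof.
move=> xL yL; apply: eq_sig_hprop; first by move=> *; apply: Prop_irrelevance.
apply/predeqP => L'; split=> h.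
  exact: vertex_closed yL (vertex_lattice h) (vertex_homothetic xL h).
exact: vertex_closed xL (vertex_lattice h) (vertex_homothetic yL h).
Qed.

(** The vertex [a, b] of classical notation, as a relation: dependent pairs give no vertex and each
    vertex has many bases. *)
Definition vrep x a b := det2 a b != 0 /\ sval x (Lat a b).

Lemma vrep_det x a b : vrep x a b -> det2 a b != 0. Proof. by case. Qed.

Lemma vrep_ex x : exists a b, vrep x a b.
Proof.
have [L xL] := vertex_ex x.
have [a [b [D0 E]]] := lattice_basis (vertex_lattice xL).
by exists a, b; split=> //; rewrite -E.
Qed.

Lemma vrep_mk a b : det2 a b != 0 -> exists x, vrep x a b.
Proof.
move=> D0; pose C L' := is_lattice v L' /\ homothetic (Lat a b) L'.
have HC : is_vertex_class v C.
  by exists (Lat a b); split=> //; apply: Lat_lattice.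
exists (exist _ C HC); split=> //=; split; first exact: Lat_lattice.
exact: homothetic_refl.
Qed.

Lemma vrep_eq x y a b : vrep x a b -> vrep y a b -> x = y.
Proof. by move=> [_ hx] [_ hy]; apply: vertex_eq hx hy. Qed.

Lemma vrep_uniq x a b a' b' : vrep x a b -> vrep x a' b' ->
  exists2 c, c != 0 & Lat a' b' = Lat (c *: a) (c *: b).
Proof.
move=> [_ h] [_ h']; have /homotheticP[c c0 E] := vertex_homothetic h h'.
by exists c => //; rewrite E Lat_scale.
Qed.

Lemma vrep_scale x a b c : c != 0 -> vrep x (c *: a) (c *: b) <-> vrep x a b.
Proof.
move=> c0; have h t a0 b0 :
    t != 0 -> vrep x a0 b0 -> vrep x (t *: a0) (t *: b0).
  move=> t0 [D0 xL]; have D1 : det2 (t *: a0) (t *: b0) != 0.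
    by rewrite det2Z !mulf_neq0.
  split=> //; apply: vertex_closed xL _ _; first exact: Lat_lattice.
  by apply/homotheticP; exists t; rewrite ?Lat_scale.
split; last exact: h.
move=> /(h c^-1); rewrite !scalerA mulVf // !scale1r; apply.
by rewrite invr_eq0.
Qed.

Lemma vrep_swap x a b : vrep x a b -> vrep x b a.
Proof. by move=> [D0 h]; split; rewrite 1?Lat_swap // det2_swap oppr_eq0. Qed.

Lemma vrep_shear x a b t : O t -> vrep x (a + t *: b) b <-> vrep x a b.
Proof. by move=> Ot; rewrite /vrep Lat_shear // det2_shear. Qed.

(** * The action of invertible matrices on vertices *)

(** [mat_act_rel] speaks of a single lattice of the class; scaling commutes with [A], which extends
    the relation to all of them. *)
Lemma mat_act_image A x y L : A \in unitmx -> mat_act_rel A x y -> sval x L ->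
  sval y (mx_image A L).
Proof.
move=> uA [L0 [xL0 yL0]] xL.
apply: vertex_closed yL0 (lattice_image uA (vertex_lattice xL)) _.
have /homotheticP[c c0 ->] := vertex_homothetic xL0 xL.
apply/homotheticP; exists c => //; apply/predeqP => w; split.
  move=> [_ [[u [Lu ->]] ->]]; exists (u *m A); split; first by exists u.
  by rewrite scalemxAl.
move=> [_ [[u [Lu ->]] ->]]; exists (c *: u); split; first by exists u.
by rewrite scalemxAl.
Qed.

Lemma mat_act_vrep A x y a b : A \in unitmx -> vrep x a b ->
  mat_act_rel A x y <-> vrep y (a *m A) (b *m A).
Proof.
move=> uA [D0 xL]; split=> [h|[_ yL]]; last first.
  by exists (Lat a b); split=> //; rewrite -Lat_image in yL.
split; last by rewrite -Lat_image; apply: mat_act_image h xL.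
by rewrite det2_image mulf_neq0 // -unitfE -unitmxE.
Qed.

Lemma mat_act_fun A x y z : A \in unitmx ->
  mat_act_rel A x y -> mat_act_rel A x z -> y = z.
Proof.
move=> uA; have [a [b xab]] := vrep_ex x.
by move=> /(mat_act_vrep _ uA xab) h /(mat_act_vrep _ uA xab); apply: vrep_eq.
Qed.

Lemma mat_act_comp A B x y z : A \in unitmx -> B \in unitmx ->
  mat_act_rel A x y -> mat_act_rel B y z -> mat_act_rel (A *m B) x z.
Proof.
move=> uA uB; have [a [b xab]] := vrep_ex x.
move=> /(mat_act_vrep _ uA xab) h /(mat_act_vrep _ uB h) h'.
by apply/(mat_act_vrep _ _ xab); rewrite ?unitmx_mul ?uA // !mulmxA.
Qed.

Lemma mat_act_inv A x y : A \in unitmx ->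
  mat_act_rel A x y -> mat_act_rel (invmx A) y x.
Proof.
move=> uA; have [a [b xab]] := vrep_ex x.
move=> /(mat_act_vrep _ uA xab) h.
by apply/(mat_act_vrep _ _ h); rewrite ?unitmx_inv // !mulmxK.
Qed.

Lemma mat_act_ex A : A \in unitmx ->
  exists f : Vertex v -> Vertex v, forall x, mat_act_rel A x (f x).
Proof.
move=> uA.
suff /choice[f Hf] : forall x, exists y, mat_act_rel A x y by exists f.
move=> x; have [a [b xab]] := vrep_ex x.
have [|y Hy] := @vrep_mk (a *m A) (b *m A).
  by rewrite det2_image mulf_neq0 ?(vrep_det xab) // -unitfE -unitmxE.
by exists y; apply/(mat_act_vrep _ _ xab).
Qed.

Lemma mat_act_adj A x y x' y' : A \in unitmx ->
  mat_act_rel A x x' -> mat_act_rel A y y' -> adj pi x y -> adj pi x' y'.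
Proof.
move=> uA hx hy [L [L' [xL [yL' [[s1 [w1 [Lw1 nw1]]] [s2 [w2 [Lw2 nw2]]]]]]]].
have inj u u' : u *m A = u' *m A -> u = u'.
  by move=> E; rewrite -(mulmxK uA u) E mulmxK.
exists (mx_image A L), (mx_image A L'); split; first exact: mat_act_image hx xL.
split; first exact: mat_act_image hy yL'.
split; split.
- move=> _ [_ [[u [Lu ->]] ->]]; exists (pi *: u); rewrite scalemxAl.
  by split=> //; apply: s1; exists u.
- exists (w1 *m A); split; first by exists w1.
  move=> [_ [[u [Lu ->]]]]; rewrite scalemxAl => /inj E.
  by apply: nw1; exists u.
- by move=> _ [u [Lu ->]]; exists u; split=> //; apply: s2.
- exists (w2 *m A); split; first by exists w2.
  by move=> [u [Lu /inj E]]; apply: nw2; rewrite E.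
Qed.

(** * Neighbours of a vertex *)

Lemma adj_vrep x y a b : adj pi x y -> vrep x a b -> exists L,
  [/\ sval y L, strict_sub (scale_set pi (Lat a b)) L & strict_sub L (Lat a b)].
Proof.
move=> [L1 [L2 [xL1 [yL2 [[s1 [w1 [Lw1 nw1]]] [s2 [w2 [Lw2 nw2]]]]]]]] [_ xL].
have /homotheticP[c c0 ->] := vertex_homothetic xL1 xL.
have inj u u' : c *: u = c *: u' -> u = u' by apply: scalerI.
exists (scale_set c L2); split; [|split|split].
- apply: vertex_closed yL2 (lattice_scale c0 (vertex_lattice yL2)) _.
  by apply/homotheticP; exists c.
- move=> w [_ [[u [Lu ->]] ->]]; exists (pi *: u); split; last first.
    by rewrite !scalerA mulrC.
  by apply: s1; exists u.
- exists (c *: w1); split; first by exists w1.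
  move=> [_ [[u [Lu ->]] E]]; apply: nw1; exists u; split=> //; apply: inj.
  by rewrite E !scalerA mulrC.
- by move=> w [u [Lu ->]]; exists u; split=> //; apply: s2.
- exists (c *: w2); split; first by exists w2.
  by move=> [u [Lu /inj E]]; apply: nw2; rewrite E.
Qed.

(** A neighbour is a line in the residue plane [Lat a b] modulo [pi]: the line spanned by [b], or
    that of some [a + t b]. *)
Lemma adj_cases x y a b : adj pi x y -> vrep x a b ->
  vrep y (pi *: a) b \/ exists2 t, O t & vrep y (a + t *: b) (pi *: b).
Proof.
move=> xy xab; have D0 := vrep_det xab.
have [L [yL [s1 [w1 [Lw1 nw1]]] [s2 [w2 [Lw2 nw2]]]]] := adj_vrep xy xab.
have [_ LD LZ _ _] := vertex_lattice yL.
have Lpi w : Lat a b w -> L (pi *: w) by move=> h; apply: s1; exists w.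
have p0 := pi_neq0.
have nab : ~ (L a /\ L b).
  move=> [La Lb]; apply: nw2; move: Lw2 => [s [t [Os Ot ->]]].
  by apply: LD; apply: LZ.
have comb s t : L (s *: a + t *: b) -> O t -> L b -> L (s *: a).
  move=> h Ot Lb; rewrite -(addrK (t *: b) (s *: a)) -scaleNr; apply: LD => //.
  by apply: LZ => //; apply: inoN.
have unitP s w : O s^-1 -> s != 0 -> L (s *: w) -> L w.
  by move=> Os s0 /(LZ s^-1 _ Os); rewrite scalerA mulVf // scale1r.
(* The case distinction is whether some vector of [L] has a unit as its coefficient on [a]. *)
have [[w [Lw [s [t [Os Ot [Ew s0 Osv]]]]]]|H] := pselect (exists w, L w /\
   exists s t, [/\ O s, O t & [/\ w = s *: a + t *: b, s != 0 & O s^-1]]).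
- right; exists (s^-1 * t); first exact: inoM.
  have La' : L (a + (s^-1 * t) *: b).
    apply: (unitP s) => //; rewrite scalerDr scalerA mulVKf //.
    by rewrite -Ew.
  split; first by rewrite -[a + _]scale1r det2Z det2_shear mul1r mulf_neq0.
  rewrite (_ : Lat _ _ = L) //; apply/predeqP => u; split.
    move=> [s' [t' [Os' Ot' ->]]]; apply: LD; first exact: LZ.
    by apply: LZ => //; apply: Lpi; apply: Lat_r.
  move=> Lu; have [s' [t' [Os' Ot' Eu]]] := s2 _ Lu.
  (* Subtracting a multiple of the new first vector leaves a multiple of [b]; a unit coefficient
     here would put [b], hence also [a], into [L]. *)
  have Lb' : L ((t' - s' * (s^-1 * t)) *: b).
    rewrite (_ : _ *: b = u + (- s') *: (a + (s^-1 * t) *: b)).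
      by apply: LD => //; apply: LZ => //; apply: inoN.
    by rewrite Eu; apply/rowP => i; rewrite !mxE; ring.
  have Oc : O (t' - s' * (s^-1 * t)) by apply: inoB => //; do !apply: inoM.
  have [[c0 Ocv]|[c [Oc' Ec]]] := unit_or_pi Oc.
    have Lb : L b by apply: unitP Lb'.
    case: nab; split=> //; rewrite -[a]scale1r.
    apply: (comb 1 (s^-1 * t)) => //.
      by rewrite scale1r.
    exact: inoM.
  exists s', c; split=> //; rewrite Eu.
  rewrite -[t'](subrK (s' * (s^-1 * t))) Ec.
  by apply/rowP => i; rewrite !mxE; ring.
have Hs w s t : L w -> O s -> O t -> w = s *: a + t *: b ->
    exists c, O c /\ s = pi * c.
  move=> Lw Os Ot Ew; have [[s0 Osv]|//] := unit_or_pi Os.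
  by case: H; exists w; split=> //; exists s, t.
(* [w1] lies outside [pi] times [Lat a b] while its first coefficient is divisible by [pi], so its
   second one is a unit. *)
have Lb : L b.
  have [s [t [Os Ot Ew]]] := s2 _ Lw1.
  have [c [Oc Es]] := Hs _ _ _ Lw1 Os Ot Ew.
  have [[t0 Otv]|[d [Od Et]]] := unit_or_pi Ot.
    apply: (unitP t) => //.
    rewrite -(addKr (s *: a) (t *: b)) -Ew Es; apply: LD => //.
    rewrite -scalerA -scalerN -scaleNr; apply: Lpi.
    rewrite -[_ *: a]addr0 -[0](scale0r b).
    by apply: Lat_mem; rewrite ?inoN ?ino0.
  case: nw1; exists (c *: a + d *: b); split; first exact: Lat_mem.
  by rewrite Ew Es Et scalerDr !scalerA.
left; split; first by rewrite -[b]scale1r det2Z mulr1 mulf_neq0.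
rewrite (_ : Lat _ _ = L) //; apply/predeqP => u; split.
  move=> [s' [t' [Os' Ot' ->]]]; apply: LD; last exact: LZ.
  by apply: LZ => //; apply: Lpi; apply: Lat_l.
move=> Lu; have [s [t [Os Ot Eu]]] := s2 _ Lu.
have [c [Oc Es]] := Hs _ _ _ Lu Os Ot Eu.
by exists c, t; split=> //; rewrite Eu Es scalerA mulrC.
Qed.

(** * Rays without backtracking and their adapted bases *)

Lemma vcloseP n s t :
  vclose v n%:Z s t <-> exists2 c, O c & s - t = pi ^+ n * c.
Proof.
have pn0 : pi ^+ n != 0 by rewrite expf_neq0 ?pi_neq0.
rewrite /vclose; have [->|d0] /= := eqVneq (s - t) 0.
  by split=> // _; exists 0; rewrite ?mulr0 ?ino0.
split=> [h|[c Oc E]].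
  exists ((pi ^+ n)^-1 * (s - t)); last by rewrite mulVKf.
  rewrite inoE ?mulf_neq0 ?invr_eq0 // valM ?invr_eq0 // valV // valX.
  by lia.
have c0 : c != 0 by apply: contraNneq d0 => c0; rewrite E c0 mulr0.
by rewrite E valM // valX lerDl -inoE.
Qed.

Definition nb_ray (z : nat -> Vertex v) :=
  (forall n, adj pi (z n) (z n.+1)) /\ (forall n, z n <> z n.+2).

(* If [z n = [a + r b, pi^n b]] and [z n.+1 = [a + r b, pi^n.+1 b]], the
   non-backtracking neighbours of [z n.+1] only alter [r] modulo [pi^n.+1];
   the successive values of [r] therefore converge. *)
Lemma nb_ray_basis (z : nat -> Vertex v) a b : v_complete v -> nb_ray z ->
  vrep (z 0%N) a b -> vrep (z 1%N) a (pi *: b) ->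
  exists2 t, O t & forall n, vrep (z n) (a + (pi * t) *: b) (pi ^+ n *: b).
Proof.
move=> Hc [zadj znb] z0 z1.
pose inv (n : nat) r := vrep (z n) (a + r *: b) (pi ^+ n *: b) /\
  vrep (z n.+1) (a + r *: b) (pi ^+ n.+1 *: b).
(* Stated for all pairs, with default [0] where the invariant fails, so that choice yields a total
   function. *)
have step (p : nat * F) : exists c, O c /\
    (inv p.1 p.2 -> inv p.1.+1 (p.2 + c * pi ^+ p.1.+1)).
  case: p => n r /=; have [[h1 h2]|H] := pselect (inv n r); last first.
    by exists 0; rewrite ino0.
  have Epi c : a + (r + c * pi ^+ n.+1) *: b =
      a + r *: b + c *: (pi ^+ n.+1 *: b).
    by rewrite scalerDl scalerA addrA.
  (* The first kind of neighbour, [pi (a + r b), pi^(n+1) b], is [z n] again and would be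
     backtracking. *)
  case: (adj_cases (zadj n.+1) h2) => [h3|[c Oc h3]].
    case: (znb n); apply: vrep_eq h1 _; apply/(vrep_scale _ _ _ pi_neq0).
    by rewrite scalerA -exprS.
  exists c; split=> // _; split; rewrite Epi; first exact/vrep_shear.
  by rewrite (exprS pi n.+1) -scalerA.
have [c Hstep] := choice step.
pose fix r n := if n is m.+1 then r m + c (m, r m) * pi ^+ m.+1 else 0.
have rinv n : inv n (r n).
  elim: n => [|n IHn]; last exact: (Hstep (n, r n)).2.
  by split; rewrite /= scale0r addr0 ?expr0 ?expr1 ?scale1r.
have rdiff n k : exists2 t, O t & r (n + k)%N - r n = pi ^+ n.+1 * t.
  elim: k => [|k [t Ot E]].
    by exists 0; rewrite ?ino0 // addn0 subrr mulr0.
  exists (t + pi ^+ k * c ((n + k)%N, r (n + k)%N)).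
    by apply: inoD => //; apply: inoM; [apply: inoX | apply: (Hstep (_, _)).1].
  rewrite addnS /= addrAC E mulrDr mulrA -exprD addSn mulrC.
  by rewrite [c _ * _]mulrC mulrC.
have rclose N m n : (N <= m)%N -> (N <= n)%N ->
    exists2 t, O t & r m - r n = pi ^+ N.+1 * t.
  move=> /subnKC <- /subnKC <-.
  have [t Ot E] := rdiff N (m - N)%N; have [t' Ot' E'] := rdiff N (n - N)%N.
  exists (t - t'); first exact: inoB.
  by rewrite mulrBr -E -E'; ring.
have [M|l Hl] := Hc r.
  have [N HN] : exists N : nat, M <= N%:Z by exists `|M|%N; lia.
  exists N => m n Nm Nn; have [t Ot E] := rclose N m n Nm Nn.
  have : vclose v N%:Z (r m) (r n).
    apply/vcloseP; exists (pi * t); first by apply: inoM => //; apply: ino_pi.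
    by rewrite E exprSr mulrA.
  rewrite /vclose => /orP[->//|h]; apply/orP; right; exact: le_trans h.
(* The estimate survives in the limit: [l] and [r n] are both compared with [r] at an index beyond
   [n] and beyond the one given by convergence. *)
have lr n : exists2 t, O t & l - r n = pi ^+ n.+1 * t.
  have [N /(_ (maxn n N)) HN] := Hl n.+1%:Z.
  have /vcloseP[t Ot E] := HN (leq_maxr _ _).
  have [t' Ot' E'] := rclose n (maxn n N) n (leq_maxl _ _) (leqnn _).
  exists (t' - t); first exact: inoB.
  by rewrite mulrBr -E -E'; ring.
have [t Ot E0] := lr 0%N; rewrite subr0 in E0.
exists t => // n; have [d Od E] := lr n.
(* Replacing [r n] by the limit adds an [O]-multiple of the second basis vector, which leaves the
   lattice unchanged. *)
rewrite -[pi]expr1 -E0 expr1 (_ : a + l *: b =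
    a + r n *: b + (pi * d) *: (pi ^+ n *: b)).
  by apply/vrep_shear; [apply: inoM => //; apply: ino_pi | exact: (rinv n).1].
rewrite -(subrK (r n) l) E scalerDl scalerA -addrA; congr (_ + _).
by rewrite addrC exprS mulrAC.
Qed.

(** Either kind of neighbour takes the required form, after exchanging the basis vectors or
    replacing [a] by [a + t b]. *)
Lemma nb_ray_start (z : nat -> Vertex v) : nb_ray z ->
  exists a b, vrep (z 0%N) a b /\ vrep (z 1%N) a (pi *: b).
Proof.
move=> [zadj _]; have [a [b zab]] := vrep_ex (z 0%N).
have [h|[t Ot h]] := adj_cases (zadj 0%N) zab.
  by exists b, a; split; apply: vrep_swap.
by exists (a + t *: b), b; split=> //; apply/vrep_shear.
Qed.

Lemma nb_ray_std (z : nat -> Vertex v) : v_complete v -> nb_ray z ->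
  exists a b, forall n, vrep (z n) a (pi ^+ n *: b).
Proof.
move=> Hc Hz; have [a [b [z0 z1]]] := nb_ray_start Hz.
have [t _ H] := nb_ray_basis Hc Hz z0 z1.
by exists (a + (pi * t) *: b), b.
Qed.

(* The two rays share the edge [p 0, p 1], traversed in opposite directions. *)
Lemma nb_line_basis (p q : nat -> Vertex v) :
  v_complete v -> nb_ray p -> nb_ray q ->
  p 0%N = q 1%N -> p 1%N = q 0%N ->
  exists a b, forall n, vrep (p n) a (pi ^+ n *: b) /\
                        vrep (q n.+1) (pi ^+ n *: a) b.
Proof.
move=> Hc Hp Hq pq0 pq1; have [a [b Ha]] := nb_ray_std Hc Hp.
have p0n := pi_neq0.
have q0 : vrep (q 0%N) (pi *: b) a.
  by rewrite -pq1; apply: vrep_swap; have := Ha 1%N; rewrite expr1.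
(* Scaling by [pi] gives [q 0] and [q 1] the common first vector [pi b] that [nb_ray_basis]
   expects. *)
have q1 : vrep (q 1%N) (pi *: b) (pi *: a).
  rewrite -pq0; apply/vrep_scale => //; apply: vrep_swap.
  by have := Ha 0%N; rewrite expr0 scale1r.
have [s Os Hb] := nb_ray_basis Hc Hq q0 q1.
(* [b + s a] comes from dividing [pi b + pi s a, pi^(n+1) a] by [pi]. For [p] the change is
   harmless, as it adds [pi^n s a], an [O]-multiple of [a]. *)
exists a, (b + s *: a) => n; split; apply: vrep_swap.
  rewrite scalerDr scalerA; apply/vrep_shear; last exact: vrep_swap (Ha n).
  by apply: inoM => //; apply: inoX.
apply/(vrep_scale _ _ _ p0n); rewrite scalerDr !scalerA -exprS.
exact: Hb n.+1.
Qed.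

(** * Change of basis and rigidity of segments *)

Lemma basis_change a b a' b' : det2 a b != 0 -> det2 a' b' != 0 ->
  exists A, [/\ A \in unitmx, a *m A = a' & b *m A = b'].
Proof.
move=> D0 D0'.
pose M : 'M[F]_2 := col_mx a b; pose M' : 'M[F]_2 := col_mx a' b'.
have uM : M \in unitmx by rewrite unitmxE unitfE det_col2.
have uM' : M' \in unitmx by rewrite unitmxE unitfE det_col2.
exists (invmx M *m M'); rewrite unitmx_mul unitmx_inv uM uM'.
have : col_mx a b *m (invmx M *m M') = col_mx a' b' := mulKVmx uM M'.
by rewrite mul_col_mx => /eq_col_mx[-> ->].
Qed.

(** Inclusions at the two ends of a segment give the inclusion in between: [a'] is controlled by the
    far end, [b'] by the near one. *)
Lemma Lat_le_mem a b a' b' n N : (n <= N)%N ->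
  Lat a b b' -> Lat a (pi ^+ N *: b) a' ->
  Lat a (pi ^+ n *: b) a' /\ Lat a (pi ^+ n *: b) (pi ^+ n *: b').
Proof.
move=> nN [s [t [Os Ot ->]]] [s' [t' [Os' Ot' ->]]]; split.
  rewrite -(subnKC nN) exprD mulrC -scalerA scalerA; apply: Lat_mem => //.
  by apply: inoM => //; apply: inoX.
rewrite scalerDr !scalerA [_ * t]mulrC -(scalerA t); apply: Lat_mem => //.
by apply: inoM => //; apply: inoX.
Qed.

(* Comparing determinants shows that the two representations of [p N] use the
   same scaling as those of [p 0]. *)
Lemma nb_ray_rigid (p p' : nat -> Vertex v) n N : v_complete v ->
  nb_ray p -> nb_ray p' -> p 0%N = p' 0%N -> p N = p' N -> (n <= N)%N ->
  p n = p' n.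
Proof.
move=> Hc Hp Hp' E0 EN nN.
have pin k : pi ^+ k != 0 by rewrite expf_neq0 ?pi_neq0.
have [a0 [b0 H0]] := nb_ray_std Hc Hp; have [a' [b' H']] := nb_ray_std Hc Hp'.
(* The scalar between the two lattices of [p 0] is absorbed into the basis, which makes them
   equal. *)
have [s s0] : exists2 s, s != 0 & Lat a' b' = Lat (s *: a0) (s *: b0).
  apply: (@vrep_uniq (p 0%N)); first by have := H0 0%N; rewrite expr0 scale1r.
  by rewrite E0; have := H' 0%N; rewrite expr0 scale1r.
have H k : vrep (p k) (s *: a0) (pi ^+ k *: (s *: b0)).
  by rewrite scalerA mulrC -scalerA; apply/vrep_scale.
move: (s *: a0) (s *: b0) H => a b H Lat0.
have [c c0 EN'] : exists2 c, c != 0 &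
    Lat a' (pi ^+ N *: b') = Lat (c *: a) (c *: (pi ^+ N *: b)).
  by apply: vrep_uniq (H N) _; rewrite EN.
have D0 : det2 a b != 0 by have := vrep_det (H 0%N); rewrite expr0 scale1r.
have D0' : det2 a' b' != 0 by have := vrep_det (H' 0%N); rewrite expr0 scale1r.
have vc : v c = 0.
  have := Lat_eq_val (vrep_det (H' N)) _ EN'.
  rewrite det2Z !det2Zr -mulrA !mulf_neq0 // => /(_ isT).
  rewrite !valM ?mulf_neq0 // (Lat_eq_val D0' D0 Lat0).
  by lia.
have LatN : Lat a' (pi ^+ N *: b') = Lat a (pi ^+ N *: b).
  have Oc : O c by rewrite inoE // vc.
  have OcV : O c^-1 by rewrite inoE ?invr_eq0 // valV // vc.
  have unscale w : w = c^-1 *: (c *: w) by rewrite scalerA mulVf // scale1r.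
  rewrite EN'; apply: Lat_eq.
  - by apply: LatZ => //; apply: Lat_l.
  - by apply: LatZ => //; apply: Lat_r.
  - by rewrite [X in Lat _ _ X]unscale; apply: LatZ => //; apply: Lat_l.
  - by rewrite [X in Lat _ _ X]unscale; apply: LatZ => //; apply: Lat_r.
apply: vrep_eq (H n) _; split; first exact: vrep_det (H n).
suff <- : Lat a' (pi ^+ n *: b') = Lat a (pi ^+ n *: b) by case: (H' n).
have [h1 h2] : Lat a (pi ^+ n *: b) a' /\ Lat a (pi ^+ n *: b) (pi ^+ n *: b').
  by apply: (Lat_le_mem nN); rewrite -?Lat0 -?LatN; [apply: Lat_r|apply: Lat_l].
have [h3 h4] :
    Lat a' (pi ^+ n *: b') a /\ Lat a' (pi ^+ n *: b') (pi ^+ n *: b).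
  by apply: (Lat_le_mem nN); rewrite ?Lat0 ?LatN; [apply: Lat_r|apply: Lat_l].
exact: Lat_eq.
Qed.

(** * Distances, automorphisms and the group [in_Ghat] *)

Lemma dist_adj x y : dist pi x y 1 -> adj pi x y.
Proof. by move=> [[p [<- <- /(_ 0%N isT)]]]. Qed.

Lemma walk0 x : walk pi x x 0.
Proof. by exists (fun=> x). Qed.

Lemma dist0 x : dist pi x x 0.
Proof. by split; first exact: walk0. Qed.

Lemma dist_uniq x y m n : dist pi x y m -> dist pi x y n -> m = n.
Proof.
move=> [wm hm] [wn hn]; apply/eqP; rewrite eqn_leq; apply/andP; split.
  exact: hm.
exact: hn.
Qed.

Lemma nb_ray_dist (z : nat -> Vertex v) :
  (forall n, dist pi (z n) (z n.+1) 1) ->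
  (forall n, dist pi (z n) (z n.+2) 2) ->
  nb_ray z.
Proof.
move=> d1 d2; split=> n; first exact: dist_adj.
by move=> E; have [_ /(_ 0%N)] := d2 n; rewrite -E => /(_ (walk0 _)).
Qed.

Implicit Types (e : nat) (f g : Vertex v -> Vertex v).

(** Respecting adjacency in both directions, [f] and its inverse carry walks to walks of the same
    length, so minimal lengths agree. *)
Lemma adj_aut f g : cancel f g -> cancel g f ->
  (forall x y, adj pi x y -> adj pi (f x) (f y)) ->
  (forall x y, adj pi x y -> adj pi (g x) (g y)) -> is_aut pi f.
Proof.
move=> fK gK fadj gadj; split; first by exists g.
have wk (h : Vertex v -> Vertex v) :
    (forall x y, adj pi x y -> adj pi (h x) (h y)) ->
    forall x y n, walk pi x y n -> walk pi (h x) (h y) n.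
  by move=> hadj x y n [p [<- <- Hp]]; exists (h \o p); split=> // i /Hp/hadj.
have wf x y n : walk pi x y n <-> walk pi (f x) (f y) n.
  by split=> [/(wk _ fadj)//|/(wk _ gadj)]; rewrite !fK.
move=> x y n; split=> -[w H].
  by split=> [|m /(wf x y m).2/H//]; apply/(wf x y n).1.
by split=> [|m /(wf x y m).1/H//]; apply/(wf x y n).2.
Qed.

Lemma mat_act_Ghat e A f : A \in unitmx ->
  (forall x, mat_act_rel A x (f x)) -> in_Ghat pi e f.
Proof.
move=> uA Hf; split; last by move=> x y _; exists A.
have uA' : invmx A \in unitmx by rewrite unitmx_inv.
have [g Hg] := mat_act_ex uA'.
have adjf B (h : Vertex v -> Vertex v) :
    B \in unitmx -> (forall x, mat_act_rel B x (h x)) ->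
    forall x y, adj pi x y -> adj pi (h x) (h y).
  by move=> uB Hh x y; apply: mat_act_adj uB _ _.
apply: (@adj_aut f g); [| |exact: adjf Hf|exact: adjf Hg] => x.
  exact: mat_act_fun uA' (Hg _) (mat_act_inv uA (Hf x)).
have := mat_act_inv uA' (Hg x); rewrite invmxK; exact: mat_act_fun uA (Hf _).
Qed.

Lemma in_ball_endpoints e x y : in_ball pi x y e x /\ in_ball pi x y e y.
Proof.
by split; exists 0%N; split=> //; [left|right]; apply: dist0.
Qed.

(** Both endpoints lie in the ball of their edge, so one matrix realizes [g] on both. *)
Lemma Ghat_adj e g x y : in_Ghat pi e g -> adj pi x y -> adj pi (g x) (g y).
Proof.
move=> [_ H] xy; have [A [uA HA]] := H _ _ xy.
have [bx by_] := in_ball_endpoints e x y.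
exact: mat_act_adj uA (HA _ bx) (HA _ by_) xy.
Qed.

Lemma Ghat_inj e g : in_Ghat pi e g -> injective g.
Proof. by move=> [[/bij_inj]]. Qed.

(** The matrix of [g] at an edge is multiplied by that of [f] at the image edge; [g] preserves
    distances, so it maps the first ball into the second. *)
Lemma Ghat_comp e f g :
  in_Ghat pi e f -> in_Ghat pi e g -> in_Ghat pi e (f \o g).
Proof.
move=> Hf Hg; split.
  case: Hf Hg => -[bf df] _ [[bg dg] _]; split; first exact: bij_comp.
  by move=> x y n; rewrite dg df.
move=> x y xy; have [A [uA HA]] := Hg.2 _ _ xy.
have [B [uB HB]] := Hf.2 _ _ (Ghat_adj Hg xy).
exists (A *m B); split=> [|z zb]; first by rewrite unitmx_mul uA.
apply: mat_act_comp uA uB (HA _ zb) (HB _ _).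
by case: zb => n [ne h]; exists n; split=> //; rewrite -!Hg.1.2.
Qed.

Lemma Ghat_nb_ray e g (z : nat -> Vertex v) :
  in_Ghat pi e g -> nb_ray z -> nb_ray (g \o z).
Proof.
move=> Hg [zadj znb]; split=> n; first exact: Ghat_adj Hg (zadj n).
by move=> /(Ghat_inj Hg)/znb.
Qed.

(** * Fixed ends and the factorization *)

Lemma fixes_end_ray e g (z : nat -> Vertex v) : v_complete v ->
  (forall m n : nat, dist pi (z m) (z n) `|m%:Z - n%:Z|%N) ->
  in_Ghat pi e g -> g (z 0%N) = z 0%N -> fixes_end g z ->
  forall n, g (z n) = z n.
Proof.
move=> Hc dz Hg g0 [a [b H]] n.
(* Distances to the fixed origin force the two index shifts to agree, so all vertices from [z a] on
   are fixed. *)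
have Eab : a = b.
  have h1 := dz a 0%N; rewrite Hg.1.2 g0 -[X in g (z X)]add0n H add0n in h1.
  have := dist_uniq h1 (dz b 0%N); rewrite !subr0; exact.
have Hz : nb_ray z.
  apply: nb_ray_dist => m.
    by have := dz m m.+1; rewrite (_ : `|_|%N = 1%N) //; lia.
  by have := dz m m.+2; rewrite (_ : `|_|%N = 2%N) //; lia.
have := @nb_ray_rigid (g \o z) z n (n + a) Hc (Ghat_nb_ray Hg Hz) Hz g0.
by apply; rewrite ?leq_addr //= H -Eab.
Qed.

Lemma line_dist (x : int -> Vertex v) (m n : int) k :
  geodesic_line pi x -> `|m - n|%N = k -> dist pi (x m) (x n) k.
Proof. by move=> Hx <-. Qed.

Lemma Ihat_factor e (x : int -> Vertex v) g : v_complete v ->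
  geodesic_line pi x -> Ihat pi e x g ->
  exists f f', [/\ Ihat pi e x f /\ Bhat pi e x f,
                   Ihat pi e x f' /\ Bhat' pi e x f' &
                   forall y, g y = f (f' y)].
Proof.
move=> Hc Hx [Hg g0 g1].
(* [q] starts at [x 1], so that [p] and [q] overlap in one edge, run through in opposite
   directions. *)
pose p (n : nat) := x n%:Z; pose q (n : nat) := x (1 - n%:Z).
have Hp : nb_ray p by apply: nb_ray_dist => n; apply: line_dist => //; lia.
have Hq : nb_ray q by apply: nb_ray_dist => n; apply: line_dist => //; lia.
have [a [b Hab]] : exists a b, forall n,
    vrep (p n) a (pi ^+ n *: b) /\ vrep (q n.+1) (pi ^+ n *: a) b.
  by apply: nb_line_basis.
(* Since [g] fixes [x 0] and [x 1], the image of [q] still overlaps [p] in that edge. *)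
have [a' [b' Hab']] : exists a b, forall n,
    vrep (p n) a (pi ^+ n *: b) /\ vrep (g (q n.+1)) (pi ^+ n *: a) b.
  by apply: (@nb_line_basis p (g \o q)) => //; apply: Ghat_nb_ray Hg Hq.
have D0 : det2 a b != 0.
  by have := vrep_det (Hab 0%N).1; rewrite expr0 scale1r.
have D0' : det2 a' b' != 0.
  by have := vrep_det (Hab' 0%N).1; rewrite expr0 scale1r.
have [A [uA Aa Ab]] := basis_change D0 D0'.
have [u Hu] := mat_act_ex uA.
have uA' : invmx A \in unitmx by rewrite unitmx_inv.
have [w Hw] := mat_act_ex uA'.
have Gu := mat_act_Ghat e uA Hu; have Gw := mat_act_Ghat e uA' Hw.
have uw y : u (w y) = y.
  have := mat_act_inv uA' (Hw y); rewrite invmxK.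
  exact: mat_act_fun uA (Hu _).
have wu y : w (u y) = y := mat_act_fun uA' (Hw _) (mat_act_inv uA (Hu y)).
(* [p n] has the same coordinates in both bases, so [u] fixes it; [q n.+1] in the first basis
   matches its image under [g] in the second, so [u] agrees with [g] there. *)
have up n : u (p n) = p n.
  apply: (mat_act_fun uA (Hu _)); apply/(mat_act_vrep _ uA (Hab n).1).
  by rewrite -scalemxAl Aa Ab; case: (Hab' n).
have uq n : u (q n.+1) = g (q n.+1).
  apply: (mat_act_fun uA (Hu _)); apply/(mat_act_vrep _ uA (Hab n).2).
  by rewrite -scalemxAl Aa Ab; case: (Hab' n).
have wgx (n : nat) : w (g (x (- n%:Z))) = x (- n%:Z).
  have -> : x (- n%:Z) = q n.+1 by rewrite /q; congr (x _); lia.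
  by rewrite -uq.
have Gwg := Ghat_comp Gw Hg.
exists u, (w \o g); split=> [||y /=]; last by rewrite uw.
- split; first by split; [|exact: (up 0%N)|exact: (up 1%N)].
  by split=> //; exists 0%N, 0%N => n; apply: up.
- split; last by split=> //; exists 0%N, 0%N => n; apply: wgx.
  split=> //=; first by rewrite g0; rewrite -[LHS](congr1 w (up 0%N)) wu.
  by rewrite g1 -[LHS](congr1 w (up 1%N)) wu.
Qed.

Lemma Ihat_comp e (x : int -> Vertex v) f g :
  Ihat pi e x f -> Ihat pi e x g -> Ihat pi e x (f \o g).
Proof.
move=> [Gf f0 f1] [Gg g0 g1]; split; first exact: Ghat_comp.
  by rewrite /= g0.
by rewrite /= g1.
Qed.

Lemma Ihat_fix_line e (x : int -> Vertex v) g : v_complete v ->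
  geodesic_line pi x -> Ihat pi e x g -> Bhat pi e x g -> Bhat' pi e x g ->
  forall k, g (x k) = x k.
Proof.
move=> Hc Hx [Hg g0 g1] [_ Bg] [_ Bg'].
have fixp : forall n, g (ray_plus x n) = ray_plus x n.
  apply: (fixes_end_ray Hc _ Hg g0 Bg) => m n; exact: Hx.
have fixm : forall n, g (ray_minus x n) = ray_minus x n.
  apply: (fixes_end_ray Hc _ Hg _ Bg'); last by rewrite /ray_minus oppr0.
  by move=> m n; apply: line_dist => //; lia.
move=> k; have [k0|k0] := leP 0 k.
  by have := fixp `|k|%N; rewrite /ray_plus gez0_abs.
by have := fixm `|k|%N; rewrite /ray_minus ltz0_abs // opprK.
Qed.

End Tree.

Theorem mainTheorem13 (F : fieldType) (v : F -> int) (pi : F) (e : nat)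
    (x : int -> Vertex v) :
  is_local_field v pi -> (1 <= e)%N -> geodesic_line pi x ->
  (forall g : Vertex v -> Vertex v,
     Ihat pi e x g <->
     exists b b' : Vertex v -> Vertex v,
       [/\ Ihat pi e x b /\ Bhat pi e x b,
           Ihat pi e x b' /\ Bhat' pi e x b' &
           forall y, g y = b (b' y)]) /\
  (forall g : Vertex v -> Vertex v,
     ((Ihat pi e x g /\ Bhat pi e x g) /\ (Ihat pi e x g /\ Bhat' pi e x g))
     <-> Hhat pi e x g).
Proof.
move=> [Hv _ Hc] _ Hx; split=> g; split.
- exact: (Ihat_factor Hv Hc Hx).
- move=> [b [b' [[Ib _] [Ib' _] E]]].
  have -> : g = b \o b' by apply/funext.
  exact: (Ihat_comp Hv Ib Ib').
- move=> [[Ig Bg] [_ Bg']].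
  have gx := Ihat_fix_line Hv Hc Hx Ig Bg Bg'.
  by split=> //; split=> //; exists 0.
- move=> [[[Gg Bg] _] gx].
  have Ig : Ihat pi e x g by split.
  split; split=> //; split=> //.
  (* [Hhat] records only the end of the positive half-line; the opposite end is fixed with zero
     shifts. *)
  by exists 0%N, 0%N => n; apply: gx.
Qed.
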